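(* Let $G$ be a finite group, $X$ a normal subset of $G$, and $H$ a subgroup of $G$ which is a perfect code of the Cayley sum graph $\mathrm{CS}(G,X)$. Then: (i) the core of $H$ in $G$ is contained in the centralizer $C_G(x)$ for each $x\in X$; (ii) if $X$ is the disjoint union of the conjugacy classes $x_1^G,\dots,x_s^G$ and $H$ is normal in $G$, then $\frac{1}{|G:H|}+\sum_{i=1}^{s}\frac{1}{|C_G(x_i):H|}=1$; (iii) if $|X|>1$ and $H$ is normal in $G$, then $X$ is a union of at least two conjugacy classes of elements of $G$.
   Context: All groups are finite. A subset $X$ of $G$ is normal if $g^{-1}Xg=X$ for all $g\in G$. For a normal subset $X$ of $G$, the Cayley sum graph $\mathrm{CS}(G,X)$ is the simple graph with vertex set $G$ in which distinct vertices $g,h$ are adjacent iff $gh\in X$. A perfect code in a graph is an independent set $C$ of vertices such that every vertex outside $C$ has exactly one neighbour in $C$. The core of $H$ in $G$ is the largest normal subgroup of $G$ contained in $H$. $x^G$ denotes the conjugacy class of $x$ in $G$ and $|A:B|$ the index.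
   Formalization: Part (ii) is stated with the extra hypothesis that the identity of G is not in X; without it the identity fails (e.g. G = H = 1, X = {1} gives 2), and whenever 1 is in X the sum equals 1 + 1/|G:H|. *)

(* Defs.v *)
From mathcomp Require Import all_boot all_order all_algebra all_fingroup.

Set Implicit Arguments.
Unset Strict Implicit.
Unset Printing Implicit Defensive.

Import GroupScope.

(* As in the library, X <| G makes sense for an arbitrary subset X of G: it   *)
(* says that X \subset G and that X is stable under conjugation by G.         *)

(* Adjacency of the graph CS(G, X), whose vertex set is G. *)
Definition cayley_sum (gT : finGroupType) (G X : {set gT}) : rel gT :=
  [rel g h | [&& g \in G, h \in G, g != h & g * h \in X]].

Lemma cayley_sum_irr (gT : finGroupType) (G X : {set gT}) :
  irreflexive (cayley_sum G X).
Proof. by move=> g; rewrite /cayley_sum /= eqxx !andbF. Qed.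

Lemma cayley_sum_sym (gT : finGroupType) (G : {group gT}) (X : {set gT}) :
  X <| G -> symmetric (cayley_sum G X).
Proof.
case/andP=> _ nXG g h; rewrite /cayley_sum /= (eq_sym h) andbCA.
case: (boolP (h \in G)) => //= hG; case: (boolP (g \in G)) => //= gG.
by rewrite -(memJ_norm (g * h) (subsetP nXG _ gG)) conjgE mulgA mulKg.
Qed.

Definition independent_set (T : finType) (e : rel T) (C : {set T}) : Prop :=
  {in C &, forall c d, ~~ e c d}.

(* Perfect codes of the graph with vertex set V and adjacency relation e. *)
Definition perfect_code (T : finType) (V : {set T}) (e : rel T)
    (C : {set T}) : Prop :=
  [/\ C \subset V,
      independent_set e C
    & forall v, v \in V -> v \notin C -> #|[set c in C | e v c]| = 1%N].

(* Main.v *)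
(* For v in G outside H, the neighbours of v in H are the c with v c in X, so
   X meets every left coset of H other than H in exactly one element, while
   X meets H at most in 1.  A normal subgroup N of G inside H satisfies
   x^n \in x N \subset x H for n in N, whence x^n = x.  If 1 \notin X, then
   |X| = |G : H| - 1; when H is normal each class in X has size
   |G : H| / |C_G(x) : H|, so a single class would have size |G : H| - 1
   dividing |G : H|, which forces |X| = 1. *)
Require Import Defs.
From mathcomp Require Import all_boot all_order all_algebra all_fingroup.

Set Implicit Arguments.
Unset Strict Implicit.
Unset Printing Implicit Defensive.

Import GroupScope.

Section SubgroupPerfectCode.

Variables (gT : finGroupType) (G H : {group gT}) (X : {set gT}).
Hypotheses (normX : X <| G) (sHG : H \subset G).
Hypothesis codeH : perfect_code G (cayley_sum G X) H.

(** A nontrivial [x] in both sets would be adjacent to the vertex [1] of [H], since [x * 1 \in X],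
    against independence. *)
Lemma perfect_code_meet x : x \in X -> x \in H -> x = 1.
Proof.
case: codeH => _ indepH _ Xx Hx; apply/eqP/negPn/negP => ntx.
have := indepH _ _ Hx (group1 H).
by rewrite /cayley_sum /= mulg1 ntx Xx group1 (subsetP sHG).
Qed.

Lemma perfect_code_card_lcoset v :
  v \in G -> v \notin H -> exists x, X :&: v *: H = [set x].
Proof.
case: codeH => _ _ codeP Gv nHv; have /eqP/cards1P[c defc] := codeP v Gv nHv.
exists (v * c); apply/setP => x; rewrite !inE mem_lcoset.
rewrite -(can2_eq (mulKVg v) (mulKg v)) -[RHS]in_set1 -defc inE.
rewrite /cayley_sum /= mulKVg Gv andbC; case Hvx: (v^-1 * x \in H) => //=.
(* These vertices are distinct because [v^-1 * x] lies in [H] while [v] does not. *)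
rewrite (subsetP sHG) //=; suff -> : v != v^-1 * x by [].
by apply: contraNneq nHv => ->.
Qed.

Lemma perfect_code_lcoset_inj x y :
  x \in X -> y \in X -> x \notin H -> y \in x *: H -> y = x.
Proof.
move=> Xx Xy nHx xHy; have Gx: x \in G by have /andP[/subsetP->] := normX.
have [z defz] := perfect_code_card_lcoset Gx nHx.
have /set1P->: y \in [set z] by rewrite -defz inE Xy.
by apply/esym/set1P; rewrite -defz inE Xx lcoset_refl.
Qed.

Lemma perfect_code_gcore x : x \in X -> gcore H G \subset 'C_G[x].
Proof.
move=> Xx; have /andP[sXG nXG] := normX.
have sNG: gcore H G \subset G := subset_trans (gcore_sub _ _) sHG.
rewrite subsetI sNG sub_cent1.
have [Hx | nHx] := boolP (x \in H).
  by rewrite (perfect_code_meet Xx Hx) group1.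
apply/centP => n Nn; apply/commgP/conjg_fixP.
apply: perfect_code_lcoset_inj; rewrite ?(memJ_norm _ (subsetP nXG n _)) //.
  exact: subsetP sNG n Nn.
(* [x^-1 * x ^ n] is the commutator [[~ x, n]], hence equals [n^-1 ^ x * n], a product of two
   elements of the core. *)
rewrite mem_lcoset -commgEl commgEr; apply: (subsetP (gcore_sub H G)).
rewrite groupM // memJ_norm ?groupV //.
exact: subsetP (gcore_norm H G) x (subsetP sXG x Xx).
Qed.

(** Here [X] avoids [H], so sending [x] to [x *: H] is a bijection from [X] onto the left cosets
    other than [H]; the successor counts [H] itself. *)
Lemma card_perfect_code : 1 \notin X -> #|X|.+1 = #|G : H|.
Proof.
move=> X1; have /andP[sXG _] := normX.
have nHX x : x \in X -> x \notin H.
  by move=> Xx; apply: contra X1 => Hx; rewrite -(perfect_code_meet Xx Hx).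
have injX: {in X &, injective (fun x => x *: H)}.
  move=> x y Xx Xy /lcoset_eqP yHx.
  exact: perfect_code_lcoset_inj (nHX y Xy) yHx.
have HlH: gval H \in lcosets H G.
  by apply/lcosetsP; exists 1; rewrite ?lcoset1 ?mul1g.
rewrite -card_lcosets -(card_in_imset injX) [RHS](cardsD1 (gval H)) HlH.
congr _.+1; apply: eq_card => A; rewrite !inE.
apply/imsetP/andP => [[x Xx ->] | [neqAH /lcosetsP[v Gv defA]]].
  split; last by rewrite mem_lcosets (subsetP (mulG_subl _ _)) ?(subsetP sXG).
  by apply: contra (nHX x Xx) => /eqP <-; apply: lcoset_refl.
have nHv: v \notin H by apply: contra neqAH => Hv; rewrite defA lcoset_id.
have [x defx] := perfect_code_card_lcoset Gv nHv.
have /setIP[Xx xHv]: x \in X :&: v *: H by rewrite defx set11.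
by exists x => //; rewrite defA; apply/esym/lcoset_eqP.
Qed.

(** A normal [H] is its own core, so [H] lies in ['C_G[x]] and indices multiply along [H],
    ['C_G[x]], [G]. *)
Lemma card_class_perfect_code x :
  H <| G -> x \in X -> (#|x ^: G| * #|'C_G[x] : H|)%N = #|G : H|.
Proof.
move=> nHG Xx; rewrite -index_cent1 Lagrange_index ?subsetIl //.
have /andP[_ nHG'] := nHG.
have sHN: H \subset gcore H G by rewrite sub_gcore.
exact: subset_trans sHN (perfect_code_gcore Xx).
Qed.

Lemma perfect_code_not_class x : H <| G -> X = x ^: G -> #|X| <= 1.
Proof.
move=> nHG defX; have Xx: x \in X by rewrite defX class_refl.
have [X1 | X1] := boolP (1 \in X).
  (* A class containing [1] is trivial; the divisibility argument handles the other case. *)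
  by move: X1; rewrite defX => /class_eqP <-; rewrite class1G cards1.
have := card_class_perfect_code nHG Xx; rewrite -defX -card_perfect_code //.
move=> eqX; have: #|X| %| #|X|.+1 by rewrite -eqX dvdn_mulr.
by rewrite -addn1 dvdn_addr // dvdn1 => /eqP->.
Qed.

(** Each summand is [#|x i ^: G|] over [#|G : H|], and disjoint class sizes add up to [#|X|], so the
    left side is [#|X|.+1] over [#|G : H|]. With [1 \in X] one would have [#|X| = #|G : H|] and a
    total above 1. *)
Lemma sum_inv_index_perfect_code (s : nat) (x : 'I_s -> gT) :
    1 \notin X -> (forall i j, i != j -> [disjoint x i ^: G & x j ^: G]) ->
    X = \bigcup_(i < s) x i ^: G -> H <| G ->
  (#|G : H|%:R^-1 + \sum_(i < s) #|'C_G[x i] : H|%:R^-1 = 1 :> rat)%R.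
Proof.
move=> X1 tiX defX nHG.
have nz_index (K : {group gT}) : (#|K : H|%:R != 0 :> rat)%R.
  by rewrite Num.Theory.pnatr_eq0 -lt0n indexg_gt0.
have cardX: #|X| = (\sum_(i < s) #|x i ^: G|)%N.
  rewrite -sum1_card defX partition_disjoint_bigcup //.
  by apply: eq_bigr => i _; rewrite sum1_card.
have class_inv i : (#|'C_G[x i] : H|%:R^-1 = #|x i ^: G|%:R / #|G : H|%:R :> rat)%R.
  have Xxi: x i \in X by rewrite defX; apply/bigcupP; exists i; rewrite ?class_refl.
  rewrite -(card_class_perfect_code nHG Xxi) GRing.natrM GRing.invfM.
  rewrite GRing.mulrA GRing.divff ?GRing.mul1r // Num.Theory.pnatr_eq0.
  by rewrite -lt0n card_gt0; apply/set0Pn; exists (x i); apply: class_refl.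
rewrite (eq_bigr _ (fun i _ => class_inv i)) -GRing.mulr_suml -GRing.natr_sum.
rewrite -cardX -[X in (X + _)%R]GRing.mul1r -GRing.mulrDl GRing.nat1r.
by rewrite card_perfect_code // GRing.divff.
Qed.

Lemma perfect_code_classes :
  1 < #|X| -> H <| G ->
  exists P : {set {set gT}}, [/\ P \subset classes G, 1 < #|P| & X = cover P].
Proof.
move=> ltX nHG; have /andP[sXG nXG] := normX; pose P := [set x ^: G | x in X].
have defX: X = cover P.
  rewrite cover_imset; apply/eqP; rewrite eqEsubset; apply/andP; split.
    by apply/subsetP => x Xx; apply/bigcupP; exists x; rewrite ?class_refl.
  by apply/bigcupsP => x Xx; rewrite class_sub_norm.
exists P; split => //; first exact: imsetS.
have /card_gt0P[x Xx]: 0 < #|X| by apply: ltnW.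
have PxG: x ^: G \in P by apply: imset_f.
(* As [P] is nonempty, failure of [1 < #|P|] would make [X] a single class. *)
rewrite ltnNge; apply/negP => leP1.
have defP: P = [set x ^: G] by apply/esym/eqP; rewrite eqEcard sub1set PxG cards1.
have defXx: X = x ^: G by rewrite defX defP /cover big_set1.
by have := perfect_code_not_class nHG defXx; rewrite leqNgt ltX.
Qed.

End SubgroupPerfectCode.

Theorem theorem3p4 (gT : finGroupType) (G H : {group gT}) (X : {set gT})
    (normX : X <| G) (sHG : H \subset G)
    (codeH : perfect_code G (cayley_sum G X) H) :
  [/\ forall x : gT, x \in X -> gcore H G \subset 'C_G[x],
      forall (s : nat) (x : 'I_s -> gT),
        1 \notin X ->
        (forall i, x i \in G) ->
        (forall i j, i != j -> [disjoint x i ^: G & x j ^: G]) ->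
        X = \bigcup_(i < s) x i ^: G ->
        H <| G ->
        (#|G : H|%:R^-1 + \sum_(i < s) #|'C_G[x i] : H|%:R^-1 = 1 :> rat)%R
    & 1 < #|X| -> H <| G ->
        exists P : {set {set gT}},
          [/\ P \subset classes G, 1 < #|P| & X = cover P]].
Proof.
split.
- exact: perfect_code_gcore.
- move=> s x X1 _; exact: sum_inv_index_perfect_code.
- exact: perfect_code_classes.
Qed.
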